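(* There exist a metric space $(X,d)$ without isolated points and a non-autonomous dynamical system $f_{1,\infty}=\{f_n\}_{n=1}^{\infty}$ on $X$ (a sequence of continuous self-maps of $X$) such that all of the following hold: (i) $(X,f_{1,\infty})$ is not finitely generated; (ii) $(X,f_{1,\infty})$ is topologically transitive; (iii) $\overline{\mathrm{Per}(f_{1,\infty})}=X$; (iv) there exist two invariant periodic points $x,y\in X$ of $f_{1,\infty}$ such that $\mathrm{orb}(x,f_{1,\infty})\cap \mathrm{orb}(y,f_{1,\infty})=\emptyset$; (v) $(X,f_{1,\infty})$ is not sensitive.
   Context: Notation: $\mathbb{N}=\{1,2,3,\ldots\}$, $\mathbb{Z}^{+}=\{0,1,2,\ldots\}$. A non-autonomous dynamical system (NADS) $(X,f_{1,\infty})$ on a metric space $(X,d)$ is a sequence $f_{1,\infty}=\{f_n\}_{n=1}^{\infty}$ of continuous maps $f_n:X\to X$. Put $f_1^{(0)}=\mathrm{id}_X$ and $f_1^{(n)}=f_n\circ f_{n-1}\circ\cdots\circ f_1$ for $n\in\mathbb{N}$. The orbit of $x\in X$ is $\mathrm{orb}(x,f_{1,\infty})=\{f_1^{(n)}(x): n\in\mathbb{Z}^+\}$. The NADS is: - topologically transitive if for every pair of nonempty open subsets $U,V$ of $X$ there exists $n\in\mathbb{Z}^+$ such that $f_1^{(n)}(U)\cap V\neq\emptyset$; - sensitive if there exists $\varepsilon>0$ such that for any $x\in X$ and any $\delta>0$ there exist $y\in X$ with $d(x,y)<\delta$ and $n\in\mathbb{Z}^+$ satisfying $d(f_1^{(n)}(x),f_1^{(n)}(y))\geq\varepsilon$;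 - finitely generated if $\{f_i: i\in\mathbb{N}\}$ is a finite set of maps. A point $x\in X$ is a periodic point of $f_{1,\infty}$ if there exists $n\in\mathbb{N}$ such that $f_1^{(nk)}(x)=x$ for all $k\in\mathbb{Z}^+$; $\mathrm{Per}(f_{1,\infty})$ is the set of all periodic points. A subset $A\subset X$ is invariant for $f_{1,\infty}$ if $f_i(A)\subset A$ for every $i\in\mathbb{N}$. A point $x$ is an invariant periodic point of $f_{1,\infty}$ if $x\in\mathrm{Per}(f_{1,\infty})$ and $\mathrm{orb}(x,f_{1,\infty})$ is an invariant set for $f_{1,\infty}$. *)

(* Defs.v *)
From mathcomp Require Import all_boot all_order all_algebra.
From mathcomp Require Import all_classical all_reals all_analysis.

Set Implicit Arguments.
Unset Strict Implicit.
Unset Printing Implicit Defensive.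

Import Order.TTheory GRing.Theory Num.Theory.

Local Open Scope classical_set_scope.
Local Open Scope ring_scope.

(* A sequence of self-maps f_1, f_2, ... is encoded as f : nat -> T -> T, with
   f n standing for f_(n+1).  Continuity of the maps is a separate hypothesis. *)

(* f_1^(n) = f_n \o ... \o f_1, i.e. f n.-1 \o ... \o f 0 in this encoding. *)
Fixpoint ncomp (T : Type) (f : nat -> T -> T) (n : nat) : T -> T :=
  if n is m.+1 then f m \o ncomp f m else id.

Definition norbit (T : Type) (f : nat -> T -> T) (x : T) : set T :=
  [set ncomp f n x | n in [set: nat]].

Definition ninvariant (T : Type) (f : nat -> T -> T) (A : set T) : Prop :=
  forall i, f i @` A `<=` A.

Definition nPer (T : Type) (f : nat -> T -> T) : set T :=
  [set x | exists n, (0 < n)%N /\ forall k, ncomp f (n * k)%N x = x].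

Definition invariant_periodic (T : Type) (f : nat -> T -> T) (x : T) : Prop :=
  nPer f x /\ ninvariant f (norbit f x).

Definition finitely_generated (T : Type) (f : nat -> T -> T) : Prop :=
  finite_set (range f).

Definition transitive_nads (T : topologicalType) (f : nat -> T -> T) : Prop :=
  forall U V : set T, open U -> U !=set0 -> open V -> V !=set0 ->
    exists n, (ncomp f n @` U) `&` V !=set0.

Definition sensitive_nads (R : realType) (X : metricType R)
    (f : nat -> X -> X) : Prop :=
  exists2 eps : R, 0 < eps &
    forall (x : X) (delta : R), 0 < delta ->
      exists (y : X) (n : nat),
        mdist x y < delta /\ eps <= mdist (ncomp f n x) (ncomp f n y).

(* Main.v *)
Require Import Defs.
From HB Require Import structures.
From mathcomp Require Import all_boot all_order all_algebra.
From mathcomp Require Import all_classical all_reals all_analysis.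
From mathcomp Require Import ring lra.

Set Implicit Arguments.
Unset Strict Implicit.
Unset Printing Implicit Defensive.

Import Order.TTheory GRing.Theory Num.Theory.

Local Open Scope classical_set_scope.
Local Open Scope ring_scope.

(** The space is the segment [0, 1] with the distance of the reals.  For c > 0,
    the Moebius map x |-> c x / (1 - x + c x) is a homeomorphism of [0, 1]
    fixing 0 and 1; in the coordinate x / (1 - x) it is multiplication by c, so
    its inverse belongs to 1/c.  List the positive rationals as c_0, c_1, ...
    and let the system apply the map of c_0, its inverse, the map of c_1, its
    inverse, and so on.  The even iterates are then the identity, and the
    iterate 2 k + 1 is the map of c_k (ncomp_even, ncomp_odd).

    - Every point has period 2, and {0} and {1} are disjoint invariant orbits.
    - Given rational points u and v inside the segment, the ratio of their
      coordinates x / (1 - x) is some c_k, and the corresponding iterate sends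
      u to v (ratio_reach).  As rational points are dense, the system is
      transitive; and as the images of 1/2 are infinitely many, so are the maps.
    - All the maps together are equicontinuous at an inner point
      (dilation_equicontinuous): large and small values of c compress a
      neighbourhood of 1/2 towards an end of the segment.  Since every iterate
      is one of these maps, the system is not sensitive. *)

(** * The segment as a metric space *)

Definition unit_segment (R : realType) : Type := {x : R | 0 <= x <= 1}.

HB.instance Definition _ (R : realType) := SubType.on (unit_segment R).
HB.instance Definition _ (R : realType) := Choice.on (unit_segment R).

(** A constant of its own, so that simplification never turns the coordinate
    into a projection of the subset type, which arithmetic tactics would treat
    as a different atom. *)
Definition coord (R : realType) (x : unit_segment R) : R := val x.

Definition segment_point (R : realType) (t : R) (t01 : 0 <= t <= 1) :
  unit_segment R := exist _ t t01.

Lemma coord_point (R : realType) (t : R) (t01 : 0 <= t <= 1) :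
  coord (segment_point t01) = t.
Proof. by []. Qed.

Lemma coord_inj (R : realType) : injective (@coord R).
Proof. exact: val_inj. Qed.

Section UnitSegmentMetric.
Variable R : realType.
Implicit Types x y z : unit_segment R.

Definition segment_dist x y : R := `|coord x - coord y|.

Fact segment_distxx x : segment_dist x x = 0.
Proof. by rewrite /segment_dist subrr normr0. Qed.

Fact segment_dist_eq0 x y : segment_dist x y = 0 -> x = y.
Proof. by move=> /normr0_eq0/eqP; rewrite subr_eq0 => /eqP/coord_inj. Qed.

Fact segment_distC x y : segment_dist x y = segment_dist y x.
Proof. exact: distrC. Qed.

Fact segment_dist_triangle y x z :
  segment_dist x z <= segment_dist x y + segment_dist y z.
Proof. exact: ler_distD. Qed.

HB.instance Definition _ := isMetric.Build R (unit_segment R)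
  segment_distxx segment_dist_eq0 segment_distC segment_dist_triangle.

End UnitSegmentMetric.

Section Segment.
Variable R : realType.
Local Notation X := (unit_segment R).
Implicit Types (x y : X) (c : {posnum R}).

Lemma segment_mdistE x y : mdist x y = `|coord x - coord y|.
Proof. by []. Qed.

Lemma coord_ge0 x : 0 <= coord x. Proof. by case/andP: (valP x). Qed.
Lemma coord_le1 x : coord x <= 1. Proof. by case/andP: (valP x). Qed.

(** The interval avoids 0 and 1 even when x is an end of the segment. *)
Lemma nbhs_open_interval x (V : set X) : nbhs x V ->
  exists a b : R, a < b /\
    forall t, a < t -> t < b -> 0 < t < 1 /\ exists2 y, coord y = t & V y.
Proof.
rewrite -metricType_numDomainType.nbhs_nbhs_mdist => -[e /= e0 eV].
exists (Num.max 0 (coord x - e)), (Num.min 1 (coord x + e)); split.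
  have := coord_ge0 x; have := coord_le1 x.
  rewrite lt_min !gt_max => *; apply/andP; split; apply/andP; split; lra.
move=> t; rewrite gt_max lt_min => /andP[t0 xt] /andP[t1 tx].
have tI : 0 <= t <= 1 by rewrite !ltW.
split; first by rewrite t0.
exists (segment_point tI) => //; apply: eV.
by rewrite /= segment_mdistE coord_point ltr_norml; apply/andP; split; lra.
Qed.

Lemma isolated_segment : isolated [set: X] = set0.
Proof.
rewrite -subset0 => x [_ [V xV VT]].
have [a [b [ab H]]] := nbhs_open_interval xV.
have [] := H ((a + a + b) / 3%:R); [lra|lra|] => _ [y yE Vy].
have [] := H ((a + b + b) / 3%:R); [lra|lra|] => _ [z zE Vz].
have yx : y = x by have : (V `&` setT) y by []; rewrite VT.
have zx : z = x by have : (V `&` setT) z by []; rewrite VT.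
move: zE; rewrite zx -yx yE; lra.
Qed.

Lemma ratr_unit_interval (q : rat) : (0 < (ratr q : R) < 1) = (0 < q < 1).
Proof. by rewrite ltr0q -(ltr_rat R) rmorph1. Qed.

Lemma open_rational (U : set X) : open U -> U !=set0 ->
  exists2 x, U x & exists2 q : rat, coord x = ratr q & 0 < q < 1.
Proof.
move=> oU [x Ux].
have [a [b [ab H]]] := nbhs_open_interval (open_nbhs_nbhs (conj oU Ux)).
have [q] := rat_in_itvoo ab; rewrite in_itv/= => /andP[aq qb].
have [q01 [y yq Uy]] := H _ aq qb.
by exists y => //; exists q => //; rewrite -ratr_unit_interval.
Qed.

(** * The maps fixing the ends of the segment *)

(** Multiplication by c in the coordinate t / (1 - t). *)
Definition mobius (c t : R) : R := c * t / (1 - t + c * t).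

Lemma mobius_den_gt0 c x : 0 < 1 - coord x + c%:num * coord x.
Proof.
have [->|x0] := eqVneq (coord x) 0; first by rewrite subr0 mulr0 addr0.
by rewrite ltr_wpDl ?subr_ge0 ?coord_le1// mulr_gt0// lt_def x0 coord_ge0.
Qed.

Fact mobius_segment c x : 0 <= mobius c%:num (coord x) <= 1.
Proof.
have den := mobius_den_gt0 c x; have := coord_le1 x => x1.
have num0 : 0 <= c%:num * coord x by rewrite mulr_ge0 ?coord_ge0.
by rewrite divr_ge0 ?(ltW den)//= ler_pdivrMr// mul1r lerDr subr_ge0.
Qed.

Definition dilation c x : X := segment_point (mobius_segment c x).

Lemma coord_dilation c x : coord (dilation c x) = mobius c%:num (coord x).
Proof. by []. Qed.

Lemma dilation1 : dilation 1%:pos = id.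
Proof.
by apply/funext => x; apply/coord_inj;
  rewrite coord_dilation /mobius/= mul1r subrK divr1.
Qed.

Lemma dilationK c : cancel (dilation c) (dilation (c%:num^-1)%:pos).
Proof.
move=> x; apply/coord_inj; rewrite !coord_dilation /mobius/=.
have den := mobius_den_gt0 c x; have cn0 : c%:num != 0 by [].
field; rewrite cn0 gt_eqF//=; lra.
Qed.

(** The quotient on the right is the ratio of the coordinates t / (1 - t) of y
    and x. *)
Lemma dilation_reach c x y : 0 < coord x < 1 -> 0 < coord y < 1 ->
  c%:num = coord y * (1 - coord x) / (coord x * (1 - coord y)) ->
  dilation c x = y.
Proof.
move=> /andP[x0 x1] /andP[y0 y1] cE; apply/coord_inj.
rewrite coord_dilation /mobius cE; field.
by apply/and3P; split; rewrite gt_eqF ?subr_gt0//; nra.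
Qed.

(** A Moebius map has difference quotients in closed form: c is the determinant
    of its matrix, and the denominators are those at the two points. *)
Lemma mdist_dilation c x y : mdist (dilation c x) (dilation c y) =
  c%:num * mdist x y /
  ((1 - coord x + c%:num * coord x) * (1 - coord y + c%:num * coord y)).
Proof.
have dx := mobius_den_gt0 c x; have dy := mobius_den_gt0 c y.
have gB : coord (dilation c x) - coord (dilation c y) =
    c%:num * (coord x - coord y) /
    ((1 - coord x + c%:num * coord x) * (1 - coord y + c%:num * coord y)).
  by rewrite !coord_dilation /mobius; field; rewrite !gt_eqF.
rewrite !segment_mdistE gB normrM normfV [`|c%:num * _|]normrM.
by rewrite (gtr0_norm (mulr_gt0 dx dy)) [`|c%:num|]gtr0_norm.
Qed.

(** The factor on the left does not depend on c: in mdist_dilation, the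
    denominator at x is at least 1 - x and the one at y is at least c y, whose
    factor c cancels the numerator. *)
Lemma dilation_equicontinuous c x y :
  (1 - coord x) * coord y * mdist (dilation c x) (dilation c y) <= mdist x y.
Proof.
have dx := mobius_den_gt0 c x; have dy := mobius_den_gt0 c y.
have x0 := coord_ge0 x; have y0 := coord_ge0 y.
have x1 := coord_le1 x; have y1 := coord_le1 y.
rewrite mdist_dilation !mulrA ler_pdivrMr ?mulr_gt0// [leRHS]mulrC.
rewrite ler_wpM2r ?mdist_ge0// -mulrA [coord y * _]mulrC.
by apply: ler_pM; rewrite ?mulr_ge0 ?lerDl ?lerDr ?mulr_ge0 ?subr_ge0.
Qed.

(** The denominators 1 - z + c z are convex combinations of 1 and c, hence at
    least the smaller of the two; unlike the bound above, this one does
    not degenerate at the ends of the segment. *)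
Lemma dilation_lipschitz c x y :
  mdist (dilation c x) (dilation c y) <=
    c%:num / Num.min 1 c%:num ^+ 2 * mdist x y.
Proof.
set m := Num.min _ _.
have m0 : 0 < m by rewrite lt_min ltr01 /=.
have den z : m <= 1 - coord z + c%:num * coord z.
  have z0 := coord_ge0 z; have z1 := coord_le1 z.
  have m1 : m <= 1 by rewrite ge_min lexx.
  have mc : m <= c%:num by rewrite ge_min lexx orbT.
  by nra.
have dx := mobius_den_gt0 c x; have dy := mobius_den_gt0 c y.
rewrite mdist_dilation mulrAC ler_wpM2r ?mdist_ge0// ler_wpM2l//.
by rewrite lef_pV2 ?posrE ?mulr_gt0 ?exprn_gt0// expr2 ler_pM ?den// ltW.
Qed.

Lemma segment_cvg (T : topologicalType) (h : T -> X) (t : T) :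
  (forall e : R, 0 < e -> \forall s \near t, mdist (h t) (h s) < e) ->
  h @ t --> h t.
Proof. by move=> H; apply/metricType_numDomainType.cvgrPdist_lt. Qed.

Lemma dilation_continuous c : continuous (dilation c).
Proof.
move=> x; apply: segment_cvg => e e0.
have k0 : 0 < c%:num / Num.min 1 c%:num ^+ 2.
  by rewrite divr_gt0// exprn_gt0// lt_min ltr01 /=.
rewrite /prop_near1 -metricType_numDomainType.nbhs_nbhs_mdist.
exists (e / (c%:num / Num.min 1 c%:num ^+ 2)) => /=; first by rewrite divr_gt0.
move=> y /= xy; apply: le_lt_trans (dilation_lipschitz c x y) _.
by rewrite mulrC -ltr_pdivlMr.
Qed.

(** * The system *)

Fact positive_rational_gt0 (q : rat) : 0 < if 0 < q then ratr q else 1 : R.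
Proof. by case: ifP => // q0; rewrite ltr0q. Qed.

(** An enumeration of the positive rationals; indices that code no positive
    rational give 1. *)
Definition ratio (k : nat) : {posnum R} :=
  PosNum (positive_rational_gt0 (odflt 1 (unpickle k))).

Lemma ratioE k : (ratio k)%:num =
  if 0 < odflt (1 : rat) (unpickle k) then ratr (odflt 1 (unpickle k)) else 1.
Proof. by []. Qed.

Lemma ratio_surj (q : rat) : 0 < q -> exists k, (ratio k)%:num = ratr q.
Proof.
by move=> q0; exists (pickle q); rewrite ratioE pickleK /= q0.
Qed.

Definition system (n : nat) : X -> X :=
  dilation (if odd n then ((ratio n./2)%:num^-1)%:pos else ratio n./2).

Lemma ncomp_even k : ncomp system k.*2 = id.
Proof.
elim: k => //= k ->; apply/funext => x /=.
by rewrite /system /= odd_double /= doubleK uphalf_double dilationK.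
Qed.

Lemma ncomp_odd k : ncomp system k.*2.+1 = dilation (ratio k).
Proof. by rewrite /= ncomp_even /system odd_double doubleK. Qed.

Lemma ncomp_dilation n : exists c, ncomp system n = dilation c.
Proof.
rewrite -(odd_double_half n); case: (odd n).
  by rewrite add1n ncomp_odd; exists (ratio n./2).
by rewrite add0n ncomp_even; exists 1%:pos; rewrite dilation1.
Qed.

Lemma ratio_reach x y (p q : rat) : coord x = ratr p -> 0 < p < 1 ->
  coord y = ratr q -> 0 < q < 1 -> exists k, dilation (ratio k) x = y.
Proof.
move=> xp /andP[p0 p1] yq /andP[q0 q1].
have /ratio_surj[k kE] : 0 < q * (1 - p) / (p * (1 - q)).
  by rewrite divr_gt0// mulr_gt0// subr_gt0.
exists k; apply: dilation_reach; rewrite ?xp ?yq ?ratr_unit_interval ?p0 ?q0//.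
by rewrite kE fmorph_div !rmorphM !rmorphB !rmorph1.
Qed.

Lemma system_transitive : transitive_nads system.
Proof.
move=> U V oU U0 oV V0.
have [x Ux [p xp p01]] := open_rational oU U0.
have [y Vy [q yq q01]] := open_rational oV V0.
have [k kE] := ratio_reach xp p01 yq q01.
by exists k.*2.+1; exists y; split => //; exists x; rewrite // ncomp_odd.
Qed.

Lemma system_nPer : nPer system = [set: X].
Proof.
apply/seteqP; split => // x _; exists 2; split => // k.
by rewrite mul2n ncomp_even.
Qed.

Lemma common_fixed_point_orbit x : (forall c, dilation c x = x) ->
  norbit system x = [set x].
Proof.
move=> fixx; apply/seteqP; split => [_ [n _ <-]|_ ->]; last by exists 0.
by have [c ->] := ncomp_dilation n; rewrite fixx.
Qed.

Lemma common_fixed_point_periodic x : (forall c, dilation c x = x) ->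
  invariant_periodic system x.
Proof.
move=> fixx; split; first by rewrite system_nPer.
rewrite common_fixed_point_orbit// => i _ [_ -> <-]; exact: fixx.
Qed.

Fact segment0_subproof : 0 <= (0 : R) <= 1. Proof. by rewrite lexx ler01. Qed.
Fact segment1_subproof : 0 <= (1 : R) <= 1. Proof. by rewrite lexx ler01. Qed.
Definition segment0 : X := segment_point segment0_subproof.
Definition segment1 : X := segment_point segment1_subproof.

Lemma dilation_segment0 c : dilation c segment0 = segment0.
Proof. by apply/coord_inj; rewrite coord_dilation /mobius coord_point mulr0 mul0r. Qed.

Lemma dilation_segment1 c : dilation c segment1 = segment1.
Proof.
by apply/coord_inj; rewrite coord_dilation /mobius coord_point mulr1 subrr add0r divff.
Qed.

Fact segment_half_subproof : 0 <= (2^-1 : R) <= 1.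
Proof. by apply/andP; split; lra. Qed.
Definition segment_half : X := segment_point segment_half_subproof.

Lemma system_not_sensitive : ~ sensitive_nads system.
Proof.
move=> [e e0 /(_ segment_half (Num.min (4%:R^-1) (e / 8%:R)))[]].
  by rewrite lt_min; apply/andP; split; lra.
(* With y > 1/4 the factor (1 - 1/2) * y exceeds 1/8, so eps / 8 suffices. *)
move=> y [n []]; rewrite lt_min => /andP[near4 near8].
have y4 : 4%:R^-1 < coord y.
  by move: near4; rewrite segment_mdistE coord_point ltr_norml => /andP[]; lra.
have [c ->] := ncomp_dilation n.
have := dilation_equicontinuous c segment_half y; rewrite coord_point.
move: near8 y4; set d := mdist _ _; set D := mdist _ _; move: (coord y) => t.
by move=> *; nra.
Qed.

(** The maps of the system send 1/2 to every 1 / (m + 2). *)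
Lemma system_not_finitely_generated : ~ finitely_generated system.
Proof.
move=> fin; apply: infinite_nat.
pose value (h : X -> X) : R := coord (h segment_half).
pose u (m : nat) : R := ratr (m.+2%:R^-1 : rat).
have u_inj : injective u.
  by move=> m n /fmorph_inj/invr_inj/eqP; rewrite eqr_nat => /eqP[].
suff sub : range u `<=` value @` range system.
  have := sub_finite_set sub (finite_image value fin).
  by rewrite (eq_finite_set (inj_card_eq (in2W u_inj))).
move=> _ [m _ <-].
have m1 : (1 : rat) < m.+2%:R by rewrite ltr1n.
have um01 : 0 < (m.+2%:R^-1 : rat) < 1.
  by rewrite invr_gt0 invf_lt1 ?m1 ?andbT// (lt_trans ltr01 m1).
have um : 0 <= u m <= 1.
  by have := um01; rewrite -ratr_unit_interval => /andP[/ltW-> /ltW->].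
have half01 : 0 < (2^-1 : rat) < 1 by [].
have half : coord segment_half = ratr (2^-1 : rat).
  by rewrite coord_point fmorphV rmorph_nat.
have [k kE] := ratio_reach half half01 (coord_point um) um01.
exists (system k.*2); first by exists k.*2.
by rewrite /value /system odd_double doubleK kE.
Qed.

End Segment.

Theorem mainTheorem2 (R : realType) :
  exists (X : metricType R) (f : nat -> X -> X),
    isolated [set: X] = set0 /\
    (forall n, continuous (f n)) /\
    ~ finitely_generated f /\
    transitive_nads f /\
    closure (nPer f) = [set: X] /\
    (exists x y : X,
      invariant_periodic f x /\ invariant_periodic f y /\
      norbit f x `&` norbit f y = set0) /\
    ~ sensitive_nads f.
Proof.
exists (unit_segment R : metricType R), (@system R).
split; first exact: isolated_segment.
split; first by move=> n; exact: dilation_continuous.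
split; first exact: system_not_finitely_generated.
split; first exact: system_transitive.
split; first by rewrite system_nPer closureT.
split; last exact: system_not_sensitive.
exists (segment0 R), (segment1 R).
have fix0 := @dilation_segment0 R; have fix1 := @dilation_segment1 R.
split; first exact: common_fixed_point_periodic.
split; first exact: common_fixed_point_periodic.
rewrite !common_fixed_point_orbit// -subset0 => _ [-> /(congr1 (@coord R))].
by rewrite !coord_point => /eqP; rewrite eq_sym oner_eq0.
Qed.
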